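(* Let $\mathfrak{A}$ be a residuated lattice and let $\Pi$ be a collection of prime filters of $\mathfrak{A}$. Then $(\Pi;\tau_h)$ and $(\Pi;\tau_d)$ are $T_0$ spaces, where $\tau_h$ is the hull-kernel topology and $\tau_d$ is the dual hull-kernel topology on $\Pi$.
   Context: A residuated lattice is an algebra $\mathfrak{A}=(A;\vee,\wedge,\odot,\rightarrow,0,1)$ such that $(A;\vee,\wedge,0,1)$ is a bounded lattice, $(A;\odot,1)$ is a commutative monoid, and $(\odot,\rightarrow)$ is an adjoint pair, i.e. $x\odot y\le z$ iff $x\le y\rightarrow z$. A filter of $\mathfrak{A}$ is a non-empty subset $F\subseteq A$ such that $x,y\in F$ implies $x\odot y\in F$, and $x\in F$, $y\in A$ imply $x\vee y\in F$. A filter is proper if it is not equal to $A$. A proper filter $P$ is prime if for all filters $F_1,F_2$, $F_1\cap F_2=P$ implies $F_1=P$ or $F_2=P$. For $X\subseteq A$ let $h(X)=\{P\in\Pi\mid X\subseteq P\}$, and write $h(x)=h(\{x\})$. The hull-kernel topology $\tau_h$ on $\Pi$ is the topology whose closed sets are the sets $h(X)$, $X\subseteq A$; the sets $d(x)=\Pi\setminus h(x)$, $x\in A$, form a base of open sets of it. The dual hull-kernel topology $\tau_d$ on $\Pi$ is the topology having $\{h(x)\mid x\in A\}$ as a base of open sets. *)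

(* Defs.v *)
From HB Require Import structures.
From mathcomp Require Import all_boot all_order.
From mathcomp Require Import boolp classical_sets topology.

Set Implicit Arguments.
Unset Strict Implicit.
Unset Printing Implicit Defensive.

Import Order.TTheory.

Local Open Scope classical_set_scope.

(* The bounds 0 and 1 of the lattice are [\bot] and [\top]; they may coincide. *)
HB.mixin Record isResiduated (d : Order.disp_t) A of Order.TBLattice d A := {
  rmul : A -> A -> A;
  rimp : A -> A -> A;
  rmulA : associative rmul;
  rmulC : commutative rmul;
  rmul1x : left_id (\top%O : A) rmul;
  rmul_adj : forall x y z : A, (rmul x y <= z)%O = (x <= rimp y z)%O
}.

#[short(type="residuatedLatticeType")]
HB.structure Definition ResiduatedLattice (d : Order.disp_t) :=
  { A of isResiduated d A & Order.TBLattice d A }.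

Notation "x \odot y" := (rmul x y) (at level 40, left associativity).

Section Filters.
Context (d : Order.disp_t) (A : residuatedLatticeType d).
Implicit Types (F P : set A) (x y z : A).

Definition rfilter F : Prop :=
  [/\ F !=set0,
      forall x y, F x -> F y -> F (x \odot y)
    & forall x y, F x -> F (x `|` y)%O].

Definition proper_rfilter F : Prop := rfilter F /\ F <> setT.

Definition prime_rfilter P : Prop :=
  proper_rfilter P /\
  forall F1 F2, rfilter F1 -> rfilter F2 -> F1 `&` F2 = P -> F1 = P \/ F2 = P.

Lemma rmul_lel x y z : (x <= y)%O -> (x \odot z <= y \odot z)%O.
Proof. by move=> xy; rewrite rmul_adj (le_trans xy)// -rmul_adj. Qed.

Lemma rmul_leL x y : (x \odot y <= x)%O.
Proof. by rewrite rmulC (le_trans (rmul_lel x (lex1 y)))// rmul1x. Qed.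

Lemma rmul_leR x y : (x \odot y <= y)%O.
Proof. by rewrite rmulC rmul_leL. Qed.

Lemma rmul_joinl x y z :
  ((x `|` y) \odot z <= (x \odot z) `|` (y \odot z))%O.
Proof. by rewrite rmul_adj leUx -!rmul_adj leUl leUr. Qed.

Lemma join_rmul x y z :
  ((x `|` y) \odot (x `|` z) <= x `|` (y \odot z))%O.
Proof.
apply: le_trans (rmul_joinl _ _ _) _; rewrite leUx; apply/andP; split.
  by apply: le_trans (rmul_leL _ _) _; exact: leUl.
rewrite rmulC; apply: le_trans (rmul_joinl _ _ _) _; rewrite leUx.
rewrite (le_trans (rmul_leL _ _) (leUl _ _))/=.
by rewrite rmulC leUr.
Qed.

Lemma rfilter_up F x y : rfilter F -> (x <= y)%O -> F x -> F y.
Proof. by case=> _ _ Fj /join_r <-; exact: Fj. Qed.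

Lemma rfilter1 F : rfilter F -> F \top%O.
Proof. by move=> fF; have [[x Fx] _ _] := fF; apply: rfilter_up (lex1 x) Fx. Qed.

Lemma rfilter_mulE F x y : rfilter F -> F (x \odot y) <-> F x /\ F y.
Proof.
move=> fF; split=> [Fxy|[]]; last by case: fF => _ + _; apply.
by split; apply: rfilter_up Fxy => //; [exact: rmul_leL|exact: rmul_leR].
Qed.

Lemma prime_rfilter_join P x y :
  prime_rfilter P -> P (x `|` y)%O <-> P x \/ P y.
Proof.
move=> [[fP _] primeP]; have [_ Pmul Pjoin] := fP.
split=> [Pxy|[Px|Py]]; last 2 first.
- exact: Pjoin.
- by rewrite joinC; exact: Pjoin.
(* The relative annihilators of [x] and then of [F1] meet exactly in [P]. *)
pose F1 := [set z | P (y `|` z)%O].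
pose F2 := [set w | forall z, F1 z -> P (z `|` w)%O].
have fF1 : rfilter F1.
  split; first by exists x; rewrite /F1/= joinC.
    move=> a b F1a F1b; apply: rfilter_up (join_rmul _ _ _) _ => //.
    exact: Pmul.
  by move=> a b F1a; rewrite /F1/= joinA; exact: Pjoin.
have fF2 : rfilter F2.
  split; first by exists y => z; rewrite /F1/= joinC.
    move=> a b F2a F2b z F1z; apply: rfilter_up (join_rmul _ _ _) _ => //.
    by apply: Pmul; [exact: F2a|exact: F2b].
  by move=> a b F2a z F1z; rewrite joinA; apply/Pjoin/F2a.
have F12 : F1 `&` F2 = P.
  apply/seteqP; split=> [z [F1z F2z]|z Pz].
    by have := F2z z F1z; rewrite joinxx.
  split; first by rewrite /F1/= joinC; exact: Pjoin.
  by move=> w _; rewrite joinC; exact: Pjoin.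
case: (primeP _ _ fF1 fF2 F12) => <-; [left|right].
  by rewrite /F1/= joinC.
by move=> z; rewrite /F1/= joinC.
Qed.

End Filters.

Section Topologies.
Context (d : Order.disp_t) (A : residuatedLatticeType d).
Variable Pi : set (set A).
Hypothesis primePi : forall P, Pi P -> prime_rfilter P.

Definition hull (X : set A) : set Pi := [set P | X `<=` val P].

Let primeP (P : Pi) : prime_rfilter (val P).
Proof. by apply: primePi; apply: set_mem (valP P). Qed.

Let filterP (P : Pi) : rfilter (val P).
Proof. by have [[]] := primeP P. Qed.

(* Two copies of the type of elements of [Pi], as each type carries at most one
   canonical topology; [primePi] is a parameter because it is what makes the
   families below closed under finite intersections. *)
Definition hull_kernel_space of (forall P, Pi P -> prime_rfilter P) : Type := Pi.
Definition dual_hull_kernel_space of (forall P, Pi P -> prime_rfilter P) : Type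
  := Pi.

Local Notation Th := (hull_kernel_space primePi).
Local Notation Td := (dual_hull_kernel_space primePi).

HB.instance Definition _ := Choice.copy Th Pi.
HB.instance Definition _ := Choice.copy Td Pi.

Definition hull_kernel_open : set (set Th) :=
  [set U | exists X : set A, ~` U = hull X].

Definition dual_hull_kernel_open : set (set Td) :=
  [set U | exists X : set A, U = \bigcup_(x in X) hull [set x]].

Let hk_openT : hull_kernel_open setT.
Proof.
exists setT; rewrite setCT; apply/seteqP; split=> [//|P] /= PT.
have [[_ nT] _] := primeP P; apply: nT.
by apply/seteqP; split.
Qed.

Let hk_openI : setI_closed hull_kernel_open.
Proof.
move=> U V [X UX] [Y VY].
exists [set z | exists x y, [/\ X x, Y y & z = (x `|` y)%O]].
rewrite setCI UX VY; apply/seteqP; split=> P /=.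
  move=> XYP _ [x [y [Xx Yy ->]]]; apply/(prime_rfilter_join _ _ (primeP P)).
  by case: XYP => H; [left|right]; exact: H.
move=> XYP; have [XP|/existsNP[x /not_implyP[Xx nPx]]] := pselect (hull X P).
  by left.
right=> y Yy; have /(prime_rfilter_join _ _ (primeP P))[] // : val P (x `|` y)%O.
by apply: XYP; exists x, y.
Qed.

Let hk_open_bigU (J : Type) (f : J -> set Th) :
  (forall i, hull_kernel_open (f i)) -> hull_kernel_open (\bigcup_i f i).
Proof.
move=> /choice[X fX]; exists (\bigcup_i X i).
rewrite setC_bigcup; apply/seteqP; split=> P /=.
  by move=> H x [i _ Xx]; have := H i I; rewrite fX; apply.
by move=> H i _; rewrite fX => x Xx; apply: H; exists i.
Qed.

HB.instance Definition _ :=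
  isOpenTopological.Build Th hk_openT hk_openI hk_open_bigU.

Let dhk_openT : dual_hull_kernel_open setT.
Proof.
exists [set \top%O]; apply/seteqP; split=> // P _.
by exists \top%O => // _ ->; exact: rfilter1.
Qed.

Let dhk_openI : setI_closed dual_hull_kernel_open.
Proof.
move=> _ _ [X ->] [Y ->].
exists [set z | exists x y, [/\ X x, Y y & z = x \odot y]].
apply/seteqP; split=> P /=.
  move=> [[x Xx xP] [y Yy yP]]; exists (x \odot y); first by exists x, y.
  by move=> _ ->; apply/rfilter_mulE => //; split; [exact: xP|exact: yP].
move=> [_ [x [y [Xx Yy ->]]] /(_ _ erefl) /(rfilter_mulE _ _ (filterP P))[Px Py]].
by split; [exists x|exists y] => // _ ->.
Qed.

Let dhk_open_bigU (J : Type) (f : J -> set Td) :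
  (forall i, dual_hull_kernel_open (f i)) ->
  dual_hull_kernel_open (\bigcup_i f i).
Proof.
move=> /choice[X fX]; exists (\bigcup_i X i).
apply/seteqP; split=> P /=.
  by move=> [i _]; rewrite fX => -[x Xx xP]; exists x => //; exists i.
by move=> [x [i _ Xx] xP]; exists i => //; rewrite fX; exists x.
Qed.

HB.instance Definition _ :=
  isOpenTopological.Build Td dhk_openT dhk_openI dhk_open_bigU.

Lemma hull_kernel_closedE (C : set Th) :
  closed C <-> exists X : set A, C = hull X.
Proof.
by rewrite -openC; split=> -[X CX]; exists X; move: CX; rewrite setCK.
Qed.

Lemma dual_hull_kernel_openE (U : set Td) :
  open U <-> exists X : set A, U = \bigcup_(x in X) hull [set x].
Proof. by []. Qed.

End Topologies.

(* Main.v *)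
(** Two distinct prime filters are separated by some element [a] of [A] lying
    in exactly one of them; the basic open sets [d(a)] of [tau_h] and [h(a)] of
    [tau_d] then each contain exactly one of the two points. *)
Require Import Defs.
From mathcomp Require Import all_boot all_order.
From mathcomp Require Import boolp classical_sets topology.

Section Kolmogorov.
Local Open Scope classical_set_scope.

Lemma neq_set_separated (T : Type) (P Q : set T) :
  P <> Q -> exists a, (P a /\ ~ Q a) \/ (Q a /\ ~ P a).
Proof.
move=> PQ; apply: contrapT => /forallNP sep; apply: PQ.
apply/seteqP; split=> a Ha; apply: contrapT => nHa; apply: (sep a).
  by left.
by right.
Qed.

(** [kolmogorov_space] asks for a neighbourhood of one point that misses the other; an open set is a
    neighbourhood of each of its points. *)
Lemma kolmogorov_open_separated (T : topologicalType) :
  (forall x y : T, x != y ->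
    exists U : set T, open U /\ ((U x /\ ~ U y) \/ (U y /\ ~ U x))) ->
  kolmogorov_space T.
Proof.
move=> sep x y /sep[U [oU xyU]]; exists U.
by case: xyU => -[Uz nUw]; [left|right]; split; rewrite inE//;
  exact: open_nbhs_nbhs.
Qed.

Context (d : Order.disp_t) (A : residuatedLatticeType d).
Context (Pi : set (set A)).
Context (primePi : forall P : set A, Pi P -> prime_rfilter P).

Lemma neq_point_separated (P Q : Pi) : P != Q ->
  exists a, (val P a /\ ~ val Q a) \/ (val Q a /\ ~ val P a).
Proof.
by move=> /eqP PQ; apply: neq_set_separated => /val_inj.
Qed.

(** An equality of propositions rather than an equivalence, so that it rewrites under negations and
    disjunctions. *)
Lemma hull1E (a : A) (P : Pi) : hull [set a] P = val P a.
Proof. by apply/propext; split=> [|Pa _ ->//]; apply. Qed.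

Lemma hull_kernel_kolmogorov : kolmogorov_space (hull_kernel_space primePi).
Proof.
apply: kolmogorov_open_separated => P Q /neq_point_separated[a PQa].
exists (~` hull [set a]); split.
  by rewrite openC; apply/hull_kernel_closedE; exists [set a].
rewrite /setC /= !hull1E.
(* Complementation swaps the two cases: the open set contains the point whose filter omits [a]. *)
by case: PQa => -[? ?]; [right|left]; split=> //; apply.
Qed.

Lemma dual_hull_kernel_kolmogorov :
  kolmogorov_space (dual_hull_kernel_space primePi).
Proof.
apply: kolmogorov_open_separated => P Q /neq_point_separated[a PQa].
exists (hull [set a]); split; last by rewrite !hull1E.
(* A basic open set is the union of a one-member family. *)
by apply/dual_hull_kernel_openE; exists [set a]; rewrite bigcup_set1.
Qed.

End Kolmogorov.

Theorem theorem3p12 (d : Order.disp_t) (A : residuatedLatticeType d)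
    (Pi : set (set A)) (primePi : forall P : set A, Pi P -> prime_rfilter P) :
  kolmogorov_space (hull_kernel_space primePi) /\
  kolmogorov_space (dual_hull_kernel_space primePi).
Proof.
split; first exact: hull_kernel_kolmogorov.
exact: dual_hull_kernel_kolmogorov.
Qed.
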